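(* For every real Banach space $X$ with $\dim X\ge 2$ and every $\lambda\in[0,1]$, $$\frac12 J_\perp(X)-2\left|\lambda-\frac12\right|\le J_\lambda^\perp(X)\le |2\lambda-1|+\min\{\lambda,1-\lambda\}\,J_\perp(X).$$
   Context: For a real Banach space $X$, $S_X=\{x\in X:\|x\|=1\}$. For $x,y\in X$, $x\perp_B y$ (Birkhoff--James orthogonality) means $\|x\|\le\|x+ty\|$ for every $t\in\mathbb R$. For $\lambda\in[0,1]$, $$J_\lambda^\perp(X)=\sup\{\min\{\|\lambda x+(1-\lambda)y\|,\|\lambda x-(1-\lambda)y\|\}: x,y\in S_X,\ x\perp_B y\}.$$ The orthogonal James constant is $J_\perp(X)=\sup\{\min\{\|x+y\|,\|x-y\|\}: x,y\in S_X,\ x\perp_B y\}$. *)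

(* Defs.v *)
From HB Require Import structures.
From mathcomp Require Import all_boot all_order all_algebra.
From mathcomp Require Import all_classical all_reals all_analysis.

Set Implicit Arguments.
Unset Strict Implicit.
Unset Printing Implicit Defensive.

Import Order.TTheory GRing.Theory Num.Theory.
Import numFieldNormedType.Exports.

Local Open Scope classical_set_scope.
Local Open Scope ring_scope.

(* [V] may be infinite-dimensional, so [free] and [\dim], which need a
   [vectType], are not available. *)
Definition dim_ge (R : realType) (V : lmodType R) (n : nat) : Prop :=
  exists v : 'I_n -> V, forall a : 'I_n -> R,
    \sum_(i < n) a i *: v i = 0 -> forall i, a i = 0.

Definition unit_sphere (R : realType) (X : normedModType R) : set X :=
  [set x | `|x| = 1].

Definition birkhoff_orthogonal (R : realType) (X : normedModType R)
    (x y : X) : Prop :=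
  forall t : R, `|x| <= `|x + t *: y|.

Definition orthogonal_unit_pairs (R : realType) (X : normedModType R) :
    set (X * X) :=
  [set p | [/\ unit_sphere p.1, unit_sphere p.2
             & birkhoff_orthogonal p.1 p.2]].

(* [sup] returns 0 on a set that is empty or not bounded above. The two sets
   below are bounded above by 2 and by |l| + |1 - l|, and they are nonempty
   as soon as the dimension of X is at least 2. *)
Definition orthogonal_james (R : realType) (X : normedModType R) : R :=
  sup [set Num.min `|p.1 + p.2| `|p.1 - p.2|
      | p in @orthogonal_unit_pairs R X].

Definition orthogonal_james_param (R : realType) (X : normedModType R)
    (l : R) : R :=
  sup [set Num.min `|l *: p.1 + (1 - l) *: p.2| `|l *: p.1 - (1 - l) *: p.2|
      | p in @orthogonal_unit_pairs R X].

Arguments orthogonal_james {R} X.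
Arguments orthogonal_james_param {R} X l.

(* Main.v *)
Require Import Defs.
From HB Require Import structures.
From mathcomp Require Import all_boot all_order all_algebra.
From mathcomp Require Import all_classical all_reals all_analysis.
From mathcomp Require Import ring lra.

Import Order.TTheory GRing.Theory Num.Theory.
Import numFieldNormedType.Exports.

Local Open Scope ring_scope.

(** Both constants are instances of one quantity [J a b], the supremum of
    [min (|a x + b y|) (|a x - b y|)] over orthogonal unit pairs: [J_perp] is
    [J 1 1] and the parametrized constant is [J l (1 - l)].  Since
    [a x + b y = k (c x + d y) + ((a - k c) x + (b - k d) y)] and [x], [y] are
    unit vectors, the triangle inequality gives
    [J a b <= k * J c d + (|a - k c| + |b - k d|)] for every [k >= 0]
    ([le_two_coef_james]).  The lower bound is this inequality for
    [(a, b) = (1, 1)], [(c, d) = (l, 1 - l)] and [k = 2]; the upper bound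
    exchanges the roles of the two pairs and takes [k = min l (1 - l)], the
    largest factor for which both remaining coefficients [l - k] and
    [1 - l - k] are nonnegative, so that they add up to [1 - 2 k = |2 l - 1|]. *)

Definition two_coef_min {R : realType} {X : normedModType R} (a b : R)
    (p : X * X) : R :=
  Num.min `|a *: p.1 + b *: p.2| `|a *: p.1 - b *: p.2|.

Definition two_coef_james {R : realType} (X : normedModType R) (a b : R) : R :=
  sup [set two_coef_min a b p | p in @orthogonal_unit_pairs R X]%classic.

Lemma ler_norm_two_coef {R : realType} {X : normedModType R} (a b c d : R)
    {k : R} {x y : X} : `|x| = 1 -> `|y| = 1 -> 0 <= k ->
  `|a *: x + b *: y|
    <= k * `|c *: x + d *: y| + (`|a - k * c| + `|b - k * d|).
Proof.
move=> x1 y1 k0.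
have -> : a *: x + b *: y = k *: (c *: x + d *: y)
                            + ((a - k * c) *: x + (b - k * d) *: y).
  by rewrite scalerDr !scalerA addrACA -!scalerDl !subrKC.
apply: (le_trans (ler_normD _ _)); rewrite normrZ (ger0_norm k0) lerD2l.
by apply: (le_trans (ler_normD _ _)); rewrite !normrZ x1 y1 !mulr1.
Qed.

Lemma ler_two_coef_min {R : realType} {X : normedModType R} (a b c d : R)
    {k : R} {p : X * X} : `|p.1| = 1 -> `|p.2| = 1 -> 0 <= k ->
  two_coef_min a b p
    <= k * two_coef_min c d p + (`|a - k * c| + `|b - k * d|).
Proof.
case: p => x y /= x1 y1 k0; rewrite /two_coef_min /=.
have plus := ler_norm_two_coef a b c d x1 y1 k0.
have y1N : `|- y| = 1 by rewrite normrN.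
have := ler_norm_two_coef a b c d x1 y1N k0; rewrite !scalerN => minus.
by case: (leP `|c *: x + d *: y|) => _; rewrite ge_min ?plus ?minus ?orbT.
Qed.

(** A pointwise affine bound passes to suprema.  Nonnegativity of [e] covers
    the empty index set, where both suprema are [0]. *)
Lemma sup_image_le_affine (R : realType) (T : Type) (S : set T) (f g : T -> R)
    (k e : R) : 0 <= k -> 0 <= e -> has_ubound [set g p | p in S]%classic ->
  (forall p, S p -> f p <= k * g p + e) ->
  sup [set f p | p in S]%classic <= k * sup [set g p | p in S]%classic + e.
Proof.
move=> k0 e0 gub fg; have [->|/set0P[p Sp]] := eqVneq S set0.
  by rewrite !image_set0 sup0 mulr0 add0r.
apply: ge_sup; first by exists (f p), p.
move=> _ [q Sq <-]; apply: (le_trans (fg q Sq)).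
by rewrite lerD2r ler_wpM2l// ub_le_sup//; exists q.
Qed.

Lemma le_two_coef_james {R : realType} (X : normedModType R) (a b c d : R)
    {k : R} : 0 <= k ->
  two_coef_james X a b
    <= k * two_coef_james X c d + (`|a - k * c| + `|b - k * d|).
Proof.
move=> k0; apply: sup_image_le_affine => //.
  exists (`|c| + `|d|) => _ [p [p1 p2 _] <-].
  (* The comparison with factor [0] is the bound [|c x + d y| <= |c| + |d|]. *)
  have := ler_two_coef_min c d 0 0 p1 p2 (lexx 0).
  by rewrite !mul0r !subr0 add0r.
by move=> p [p1 p2 _]; exact: ler_two_coef_min.
Qed.

Lemma orthogonal_jamesE (R : realType) (X : normedModType R) :
  orthogonal_james X = two_coef_james X 1 1.
Proof.
congr sup; apply: eq_imagel => p _.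
by rewrite /two_coef_min !scale1r.
Qed.

Theorem proposition3p1 (R : realType) (X : completeNormedModType R)
    (hX : dim_ge X 2) (l : R) (hl : 0 <= l <= 1) :
  1 / 2 * orthogonal_james X - 2 * `|l - 1 / 2| <= orthogonal_james_param X l
  /\
  orthogonal_james_param X l
    <= `|2 * l - 1| + Num.min l (1 - l) * orthogonal_james X.
Proof.
have [l0 l1] := andP hl.
rewrite orthogonal_jamesE.
rewrite -[orthogonal_james_param X l]/(two_coef_james X l (1 - l)).
split.
  have := le_two_coef_james X 1 1 l (1 - l) (ler0n R 2).
  have -> : 1 - 2 * l = - (2 * (l - 1 / 2)) by field.
  have -> : 1 - 2 * (1 - l) = 2 * (l - 1 / 2) by field.
  rewrite normrN normrM ger0_norm//; lra.
have m0 : 0 <= Num.min l (1 - l) by rewrite le_min l0 subr_ge0.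
apply: (le_trans (le_two_coef_james X l (1 - l) 1 1 m0)).
rewrite addrC lerD2r !mulr1.
case: (leP l (1 - l)) => h; rewrite subrr normr0.
  by rewrite ger0_norm ?ler0_norm; lra.
by rewrite !ger0_norm; lra.
Qed.
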